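(* Let $\{f_n\}_{n\ge1}$ be a sequence of Boolean functions $f_n:\{0,1\}^{m_n}\to\{0,1\}$ and $\{p_n\}$ be a sequence in $[0,1]$. If $\{f_n\}_{n\ge1}$ is lame with respect to $\{p_n\}$, then it is degenerate with respect to $\{p_n\}$.
   Context: For each $n$, $X^{(n)}(t)=(X^{(n)}_1(t),\dots,X^{(n)}_{m_n}(t))$, $t\ge0$, where the coordinates are independent stationary continuous-time Markov chains on $\{0,1\}$ jumping from $0$ to $1$ at rate $p_n$ and from $1$ to $0$ at rate $1-p_n$ (so each is $1$ with probability $p_n$ at any fixed time). $C_n$ is the number of times $f_n(X^{(n)}(t))$ changes state during $[0,1]$. The sequence is lame with respect to $\{p_n\}$ if $\lim_{n\to\infty}\mathbb{P}(C_n=0)=1$. It is degenerate with respect to $\{p_n\}$ if $\lim_{n\to\infty}\mathbb{P}(f_n(X^{(n)}(0))=1)\,\mathbb{P}(f_n(X^{(n)}(0))=0)=0$. *)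

(* Defs.v *)
From HB Require Import structures.
From mathcomp Require Import all_boot all_order all_algebra.
From mathcomp Require Import all_classical all_reals all_analysis.

Set Implicit Arguments.
Unset Strict Implicit.
Unset Printing Implicit Defensive.

Import Order.TTheory GRing.Theory Num.Theory.
Import numFieldNormedType.Exports.

Local Open Scope classical_set_scope.
Local Open Scope ring_scope.

(* Time is [0, +oo[ inside R: a process is a function R -> T -> S, and its
   values at negative times are never used. *)

Definition sigma_of_process (R : realType) (T S : Type) (D : set R)
    (X : R -> T -> S) : set (set T) :=
  <<s [set A | exists2 t, D t & exists x, A = [set w | X t w = x]] >>.

Definition transition_semigroup (R : realType) (S : finType)
    (K : R -> S -> S -> R) : Prop :=
  [/\ forall t x y, 0 <= t -> 0 <= K t x y,
      forall t x, 0 <= t -> \sum_y K t x y = 1,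
      forall x y, K 0 x y = (x == y)%:R
    & forall s t x z, 0 <= s -> 0 <= t ->
        K (s + t) x z = \sum_y K s x y * K t y z].

(* The diagonal of the generator is determined by the off-diagonal rates,
   since the rows of K sum to 1. *)
Definition has_jump_rates (R : realType) (S : finType)
    (q : S -> S -> R) (K : R -> S -> S -> R) : Prop :=
  forall x y, x != y -> K h x y / h @[h --> 0^'+] --> q x y.

(* Markov property with respect to the natural filtration,
     P(X_t = y | A, X_s = x) = K (t - s) x y  for A in the past of time s,
   with the conditioning event multiplied out. *)
Definition markov_property (R : realType) (d : measure_display)
    (T : measurableType d) (P : probability T R) (S : finType)
    (K : R -> S -> S -> R) (X : R -> T -> S) : Prop :=
  forall (s t : R) (x y : S) (A : set T), 0 <= s -> s <= t ->
    sigma_of_process `[0, s] X A ->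
    P (A `&` [set w | X s w = x] `&` [set w | X t w = y]) =
    (P (A `&` [set w | X s w = x]) * (K (t - s) x y)%:E)%E.

Definition cadlag_path (R : realType) (S : Type) (g : R -> S) : Prop :=
  (forall t, 0 <= t -> \forall s \near t^'+, g s = g t) /\
  (forall t, 0 < t -> exists x, \forall s \near t^'-, g s = x).

Definition continuous_time_markov_chain (R : realType) (d : measure_display)
    (T : measurableType d) (P : probability T R) (S : finType)
    (q : S -> S -> R) (X : R -> T -> S) : Prop :=
  [/\ forall t x, 0 <= t -> measurable [set w | X t w = x],
      forall w, cadlag_path (fun t => X t w)
    & exists K, [/\ transition_semigroup K, has_jump_rates q K
                  & markov_property P K X]].

Definition stationary_process (R : realType) (d : measure_display)
    (T : measurableType d) (P : probability T R) (S : Type)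
    (X : R -> T -> S) : Prop :=
  forall (k : nat) (t : 'I_k -> R) (x : 'I_k -> S) (h : R),
    0 <= h -> (forall j, 0 <= t j) ->
    P [set w | forall j, X (t j + h) w = x j] =
    P [set w | forall j, X (t j) w = x j].

(* As setT belongs to each sigma-algebra, the product rule over the full
   finite family contains the one over every subfamily. *)
Definition independent_processes (R : realType) (d : measure_display)
    (T : measurableType d) (P : probability T R) (S : Type) (I : finType)
    (X : I -> R -> T -> S) : Prop :=
  forall A : I -> set T,
    (forall i, sigma_of_process `[0, +oo[ (X i) (A i)) ->
    P (\bigcap_i A i) = (\prod_i fine (P (A i)))%:E.

(* Only the off-diagonal values are meaningful. *)
Definition flip_rate (R : realType) (p : R) (x y : bool) : R :=
  match x, y with
  | false, true => p
  | true, false => 1 - p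
  | _, _ => 0
  end.

Definition dynamical_bits (R : realType) (d : measure_display)
    (T : measurableType d) (P : probability T R) (m : nat) (p : R)
    (X : 'I_m -> R -> T -> bool) : Prop :=
  (forall i, continuous_time_markov_chain P (flip_rate p) (X i) /\
             stationary_process P (X i)) /\
  independent_processes P X.

Definition observed (R : realType) (T : Type) (m : nat)
    (f : {ffun 'I_m -> bool} -> bool) (X : 'I_m -> R -> T -> bool)
    (t : R) (w : T) : bool :=
  f [ffun i => X i t w].

(* The number of t in ]0, 1] at which the path g differs from its left limit
   (+oo if there are infinitely many). Right-continuous paths do not change
   state at time 0. *)
Definition number_of_changes (R : realType) (g : R -> bool) : \bar R :=
  counting [set t : R | 0 < t <= 1 /\ ~ (\forall s \near t^'-, g s = g t)].

Definition lame (R : realType) (d : nat -> measure_display)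
    (T : forall n, measurableType (d n)) (P : forall n, probability (T n) R)
    (m : nat -> nat) (f : forall n, {ffun 'I_(m n) -> bool} -> bool)
    (X : forall n, 'I_(m n) -> R -> T n -> bool) : Prop :=
  P n [set w | number_of_changes (fun t => observed (f n) (X n) t w) = 0%E]
    @[n --> \oo] --> 1%E.

Definition degenerate (R : realType) (d : nat -> measure_display)
    (T : forall n, measurableType (d n)) (P : forall n, probability (T n) R)
    (m : nat -> nat) (f : forall n, {ffun 'I_(m n) -> bool} -> bool)
    (X : forall n, 'I_(m n) -> R -> T n -> bool) : Prop :=
  (P n [set w | observed (f n) (X n) 0 w = true] *
   P n [set w | observed (f n) (X n) 0 w = false])%E
    @[n --> \oo] --> 0%E.

(* Main.v *)
Require Import Defs.
From HB Require Import structures.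
From mathcomp Require Import all_boot all_order all_algebra.
From mathcomp Require Import all_classical all_reals all_analysis.
From mathcomp Require Import ring lra.

Set Implicit Arguments.
Unset Strict Implicit.
Unset Printing Implicit Defensive.

Import Order.TTheory GRing.Theory Num.Theory.
Import numFieldNormedType.Exports.

Local Open Scope classical_set_scope.
Local Open Scope ring_scope.

(* If there is no change on [0, 1] then [f(X(0)) = f(X(1))], so it suffices to
   bound [P(f(X(0)) != f(X(1)))] below by a constant multiple of
   [Var f = P(f = 1) P(f = 0)], independently of [p] and of the number of bits.
   By stationarity the pair [(X_i(0), X_i(1))] has the law "keep the bit with
   probability [l], else resample it", where [l] is the second eigenvalue of
   the transition matrix at time 1; it is at most 2/3 because the total jump
   rate is 1. Tensorizing gives
   [E f(X(0)) f(X(1)) <= rho E f^2 + (1 - rho) (E f)^2] with [rho = 2/3], which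
   applied to [f] and [1 - f] yields
   [P(f(X(0)) = f(X(1))) <= 1 - 2 (1 - rho) Var f]. *)

(** * Quadratic form of independent noisy bits *)

(** Joint law of a bit drawn from [pi] and a copy that is kept with probability [l] and otherwise
    drawn afresh from [pi]. *)
Definition noisy_pair_weight (R : realFieldType) (pi : bool -> R) (l : R)
    (a b : bool) : R :=
  pi a * (l * (a == b)%:R + (1 - l) * pi b).

(** The gap between the two sides is the variance of [D] under [w]. *)
Lemma weighted_jensen (R : realFieldType) (V : finType) (w D : V -> R) :
  (forall x, 0 <= w x) -> \sum_x w x = 1 ->
  (\sum_x w x * D x) ^+ 2 <= \sum_x w x * D x ^+ 2.
Proof.
move=> w0 w1; have [M ME] : {M | \sum_x w x * D x = M} by eexists.
have : 0 <= \sum_x w x * (D x - M) ^+ 2.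
  by apply: sumr_ge0 => x _; rewrite mulr_ge0 ?sqr_ge0.
have -> : \sum_x w x * (D x - M) ^+ 2 =
    \sum_x w x * D x ^+ 2 - (2 * M) * (\sum_x w x * D x) +
    M ^+ 2 * \sum_x w x.
  rewrite !mulr_sumr -sumrB -big_split /=.
  by apply: eq_bigr => x _; ring.
rewrite w1 ME; lra.
Qed.

(** Induction step that adds one coordinate [a] to a pair law [J] with marginal [w]. The new kernel
    is [l] times the identity plus [1 - l] times averaging, so the form splits into those of
    [F true], [F false] and their [pi]-average; the hypothesis on [J] is applied to all three. *)
Lemma noise_bound_step (R : realFieldType) (V : finType) (w : V -> R)
    (J : V -> V -> R) (pi : bool -> R) (l rho : R) (F : bool -> V -> R) :
  (forall x, 0 <= w x) -> \sum_x w x = 1 ->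
  (forall a, 0 <= pi a) -> pi true + pi false = 1 ->
  0 <= l -> l <= rho -> rho <= 1 ->
  (forall G : V -> R, \sum_x \sum_y J x y * (G x * G y) <=
    rho * (\sum_x w x * G x ^+ 2) + (1 - rho) * (\sum_x w x * G x) ^+ 2) ->
  \sum_a \sum_x \sum_b \sum_y
    noisy_pair_weight pi l a b * J x y * (F a x * F b y) <=
  rho * (\sum_a \sum_x pi a * w x * F a x ^+ 2) +
  (1 - rho) * (\sum_a \sum_x pi a * w x * F a x) ^+ 2.
Proof.
move=> w0 w1 pi0 pi1 l0 lrho rho1 IH.
pose B a b := \sum_x \sum_y J x y * (F a x * F b y).
pose S a b := \sum_x w x * (F a x * F b x).
pose M a := \sum_x w x * F a x.
have -> : \sum_a \sum_x \sum_b \sum_y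
    noisy_pair_weight pi l a b * J x y * (F a x * F b y) =
    \sum_a \sum_b noisy_pair_weight pi l a b * B a b.
  apply: eq_bigr => a _; rewrite exchange_big /=; apply: eq_bigr => b _.
  rewrite mulr_sumr; apply: eq_bigr => x _; rewrite mulr_sumr.
  by apply: eq_bigr => y _; ring.
have -> : \sum_a \sum_x pi a * w x * F a x ^+ 2 = \sum_a pi a * S a a.
  apply: eq_bigr => a _; rewrite mulr_sumr; apply: eq_bigr => x _.
  by rewrite -mulrA expr2.
have -> : \sum_a \sum_x pi a * w x * F a x = \sum_a pi a * M a.
  apply: eq_bigr => a _; rewrite mulr_sumr; apply: eq_bigr => x _.
  by rewrite -mulrA.
pose p := pi true; have qE : pi false = 1 - p by rewrite /p; lra.
have p0 : 0 <= p := pi0 true.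
have q0 : 0 <= 1 - p by rewrite -qE.
have S2E a : \sum_x w x * F a x ^+ 2 = S a a.
  by apply: eq_bigr => x _; rewrite expr2.
have Ht := IH (F true); have Hf := IH (F false).
rewrite -/(B true true) -/(B false false) -/(M true) -/(M false) !S2E in Ht Hf.
have Hbar := IH (fun x => p * F true x + (1 - p) * F false x).
have BE : \sum_x \sum_y J x y * ((p * F true x + (1 - p) * F false x) *
    (p * F true y + (1 - p) * F false y)) =
    p ^+ 2 * B true true + p * (1 - p) * (B true false + B false true) +
    (1 - p) ^+ 2 * B false false.
  rewrite /B mulrDr !mulr_sumr -!big_split /=; apply: eq_bigr => x _.
  rewrite !mulr_sumr -!big_split /=; apply: eq_bigr => y _; ring.
have SE : \sum_x w x * (p * F true x + (1 - p) * F false x) ^+ 2 =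
    p ^+ 2 * S true true + 2 * p * (1 - p) * S true false +
    (1 - p) ^+ 2 * S false false.
  by rewrite /S !mulr_sumr -!big_split /=; apply: eq_bigr => x _; ring.
have ME : \sum_x w x * (p * F true x + (1 - p) * F false x) =
    p * M true + (1 - p) * M false.
  by rewrite /M !mulr_sumr -!big_split /=; apply: eq_bigr => x _; ring.
rewrite BE SE ME in Hbar.
have DE : (M true - M false) ^+ 2 <=
    S true true - 2 * S true false + S false false.
  have := weighted_jensen (fun x => F true x - F false x) w0 w1.
  have -> : \sum_x w x * (F true x - F false x) = M true - M false.
    by rewrite /M -sumrB; apply: eq_bigr => x _; ring.
  have -> // : \sum_x w x * (F true x - F false x) ^+ 2 =
    S true true - 2 * S true false + S false false.
  by rewrite /S mulr_sumr -sumrB -big_split; apply: eq_bigr => x _ /=; ring.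
rewrite !big_bool /noisy_pair_weight /= -/p qE.
move: (B true true) (B true false) (B false true) (B false false) Ht Hf Hbar.
move: (S true true) (S true false) (S false false) (M true) (M false) DE.
move=> S11 S10 S00 M1 M0 DE B11 B10 B01 B00 Ht Hf Hbar {IH BE SE ME S2E}.
have rho0 : 0 <= rho by lra.
have l1 : 0 <= 1 - l by lra.
have H1 := ler_wpM2l (mulr_ge0 l0 p0) Ht.
have H2 := ler_wpM2l (mulr_ge0 l0 q0) Hf.
have H3 := ler_wpM2l l1 Hbar.
have pq0 : 0 <= p * (1 - p) by rewrite mulr_ge0.
rewrite -subr_ge0 in DE.
(* The three bounds leave a slack of [p * (1 - p)] times [rho * (1 - l) * (S11 - 2 * S10 + S00) - l
   * (1 - rho) * (M1 - M0) ^+ 2]. By [DE] the second factor is at least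
   [(rho - l) * (M1 - M0) ^+ 2], and [l <= rho]. *)
have H4 := mulr_ge0 (mulr_ge0 pq0 (mulr_ge0 rho0 l1)) DE.
have H5 : 0 <= p * (1 - p) * ((rho - l) * (M1 - M0) ^+ 2).
  by rewrite (mulr_ge0 pq0)// mulr_ge0 ?sqr_ge0// subr_ge0.
lra.
Qed.

Definition ffun_cons (m : nat) (b : bool) (x : {ffun 'I_m -> bool}) :
    {ffun 'I_m.+1 -> bool} :=
  [ffun i => if unlift ord0 i is Some j then x j else b].

Lemma ffun_cons0 (m : nat) (b : bool) (x : {ffun 'I_m -> bool}) :
  ffun_cons b x ord0 = b.
Proof. by rewrite ffunE unlift_none. Qed.

Lemma ffun_cons_lift (m : nat) (b : bool) (x : {ffun 'I_m -> bool}) i :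
  ffun_cons b x (lift ord0 i) = x i.
Proof. by rewrite ffunE liftK. Qed.

Lemma sum_ffun_cons (V : nmodType) (m : nat)
    (G : {ffun 'I_m.+1 -> bool} -> V) :
  \sum_x G x = \sum_b \sum_x G (ffun_cons b x).
Proof.
rewrite pair_big /=.
rewrite (reindex
  (fun bx : bool * {ffun 'I_m -> bool} => ffun_cons bx.1 bx.2)) //=.
exists (fun x => (x ord0, [ffun i => x (lift ord0 i)])) => [[b x] _|x _] /=.
  rewrite ffun_cons0; congr pair; apply/ffunP => i.
  by rewrite ffunE ffun_cons_lift.
apply/ffunP => i; case: (unliftP ord0 i) => [j|] ->.
  by rewrite ffun_cons_lift ffunE.
by rewrite ffun_cons0.
Qed.

Lemma sum_ffun0 (V : nmodType) (G : {ffun 'I_0 -> bool} -> V) x0 :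
  \sum_x G x = G x0.
Proof.
rewrite (bigD1 x0) //= big1 ?addr0// => x /eqP[].
by apply/ffunP => -[].
Qed.

Lemma sum_product_weight (R : realFieldType) (m : nat)
    (pi : 'I_m -> bool -> R) :
  (forall i, pi i true + pi i false = 1) ->
  \sum_(x : {ffun 'I_m -> bool}) \prod_i pi i (x i) = 1.
Proof.
move=> pi1; rewrite -(bigA_distr_bigA pi) big1 // => i _.
by rewrite big_bool -[RHS](pi1 i).
Qed.

(* Tensorization: a kernel [l_i Id + (1 - l_i) E_i] with [l_i <= rho] in each
   coordinate is dominated, as a quadratic form, by [rho Id + (1 - rho) E]. *)
Lemma noise_bound (R : realFieldType) (rho : R) (m : nat)
    (pi : 'I_m -> bool -> R) (l : 'I_m -> R) (F : {ffun 'I_m -> bool} -> R) :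
  (forall i a, 0 <= pi i a) -> (forall i, pi i true + pi i false = 1) ->
  (forall i, 0 <= l i <= rho) -> rho <= 1 ->
  \sum_(x : {ffun 'I_m -> bool}) \sum_(y : {ffun 'I_m -> bool})
    (\prod_i noisy_pair_weight (pi i) (l i) (x i) (y i)) * (F x * F y) <=
  rho * (\sum_(x : {ffun 'I_m -> bool}) (\prod_i pi i (x i)) * F x ^+ 2) +
  (1 - rho) * (\sum_(x : {ffun 'I_m -> bool}) (\prod_i pi i (x i)) * F x) ^+ 2.
Proof.
elim: m pi l F => [|m IH] pi l F pi0 pi1 lrho rho1.
  (* Without coordinates there is a single point and both sides equal [F x0 ^+ 2]. *)
  pose x0 : {ffun 'I_0 -> bool} := [ffun=> false].
  by rewrite !(sum_ffun0 _ x0) !big_ord0; lra.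
pose pi' i := pi (lift ord0 i); pose l' i := l (lift ord0 i).
have /andP[l0 l0rho] := lrho ord0.
have step := @noise_bound_step R _
  (fun x : {ffun 'I_m -> bool} => \prod_i pi' i (x i))
  (fun x y => \prod_i noisy_pair_weight (pi' i) (l' i) (x i) (y i))
  (pi ord0) (l ord0) rho (fun b x => F (ffun_cons b x)).
rewrite !sum_ffun_cons.
under [X in X <= _]eq_bigr => a _ do under eq_bigr => x _ do
  rewrite sum_ffun_cons.
under [X in X <= _]eq_bigr => a _ do under eq_bigr => x _ do
  under eq_bigr => b _ do under eq_bigr => y _ do
  (rewrite big_ord_recl !ffun_cons0; under eq_bigr do rewrite !ffun_cons_lift).
under [X in rho * X]eq_bigr => a _ do under eq_bigr => x _ do
  (rewrite big_ord_recl ffun_cons0; under eq_bigr do rewrite !ffun_cons_lift).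
under [X in X ^+ 2]eq_bigr => a _ do under eq_bigr => x _ do
  (rewrite big_ord_recl ffun_cons0; under eq_bigr do rewrite !ffun_cons_lift).
apply: step => //.
- by move=> x; apply: prodr_ge0 => i _; apply: pi0.
- by apply: sum_product_weight => i; apply: pi1.
- by move=> G; apply: IH => // [i a|i|i]; [apply: pi0|apply: pi1|apply: lrho].
Qed.

(** * Relaxation of a two-state semigroup *)

(** Trace minus 1: the eigenvalue of the stochastic matrix [K t] besides 1. *)
Definition relaxation (R : realType) (K : R -> bool -> bool -> R) (t : R) : R :=
  1 - K t false true - K t true false.

(** The eigenvalues being 1 and [relaxation K t], the latter is the determinant of [K t], and
    determinants are multiplicative. *)
Lemma relaxationD (R : realType) (K : R -> bool -> bool -> R) (s t : R) :
  transition_semigroup K -> 0 <= s -> 0 <= t ->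
  relaxation K (s + t) = relaxation K s * relaxation K t.
Proof.
case=> _ K1 _ KD s0 t0.
have row r x : 0 <= r -> K r x x = 1 - K r x (~~ x).
  by move=> r0; have := K1 r x r0; rewrite big_bool; case: x => /= <-; ring.
rewrite /relaxation !KD// !big_bool /= !row//=; ring.
Qed.

(** The value at [t] is the square of the value at [t / 2]. *)
Lemma relaxation_ge0 (R : realType) (K : R -> bool -> bool -> R) (t : R) :
  transition_semigroup K -> 0 <= t -> 0 <= relaxation K t.
Proof.
move=> semiK t0; have t20 : 0 <= t / 2 by lra.
by rewrite (splitr t) relaxationD// -expr2 sqr_ge0.
Qed.

Lemma relaxation_mulrn (R : realType) (K : R -> bool -> bool -> R) (h : R) n :
  transition_semigroup K -> 0 <= h ->
  relaxation K (h *+ n) = relaxation K h ^+ n.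
Proof.
move=> semiK h0; elim: n => [|n IH].
  by case: semiK => _ _ K0 _; rewrite expr0 mulr0n /relaxation !K0 /=; ring.
by rewrite mulrS relaxationD// ?mulrn_wge0// IH exprS.
Qed.

Lemma bernoulli_ineq (R : realDomainType) (x : R) n :
  0 <= x -> 1 + x *+ n <= (1 + x) ^+ n.
Proof.
move=> x0; elim: n => [|n IH]; first by rewrite mulr0n addr0 expr0.
rewrite exprS (le_trans _ (ler_wpM2l _ IH)) ?addr_ge0//.
rewrite mulrDl mul1r mulrS mulrDr mulr1 addrA -[leLHS]addr0 addrA addr0.
have := mulr_ge0 x0 (mulrn_wge0 n x0); lra.
Qed.

(* The true value is [exp (-1)]: the total jump rate is [p + (1 - p) = 1].
   Any bound below 1 that does not depend on [p] would do. *)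
Lemma relaxation1_le (R : realType) (K : R -> bool -> bool -> R) (p : R) :
  transition_semigroup K -> has_jump_rates (flip_rate p) K ->
  relaxation K 1 <= 2 / 3.
Proof.
move=> semiK rateK.
have rate : (1 - relaxation K h) / h @[h --> 0^'+] --> (1 : R).
  have pE : flip_rate p false true + flip_rate p true false = 1.
    by rewrite /flip_rate; ring.
  have -> : (fun h => (1 - relaxation K h) / h) =
      (fun h => K h false true / h + K h true false / h).
    by apply/funext => h /=; rewrite /relaxation -mulrDl; congr (_ / _); ring.
  by rewrite -[X in _ --> X]pE; apply: cvgD; apply: rateK.
(* Any threshold below the limit 1 would serve in place of [1 / 2]. The step is the inverse of an
   integer so that [n.+1] steps reach time 1 exactly. *)
have [n /= hn] : exists n, 1 / 2 < (1 - relaxation K n.+1%:R^-1) / n.+1%:R^-1.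
  have : \forall h \near 0^'+, 1 / 2 < (1 - relaxation K h) / h.
    by apply: (cvgr_gt _ rate); lra.
  move=> [e /= e0 He].
  have [n _ Hn] := near_infty_natSinv_lt (PosNum e0).
  exists n; apply: He => //=.
  by rewrite sub0r normrN ger0_norm; [exact: Hn (leqnn n)|].
move: hn; set h := n.+1%:R^-1 => hn.
have h0 : 0 < h by rewrite invr_gt0.
have h1 : h *+ n.+1 = 1 by rewrite -mulr_natr mulVf.
have lh : relaxation K h <= 1 - h / 2 by move: hn; rewrite ltr_pdivlMr//; lra.
have lh0 := relaxation_ge0 semiK (ltW h0).
rewrite -[X in relaxation K X]h1 relaxation_mulrn ?(ltW h0)//.
(* Since [(1 - h / 2) * (1 + h / 2) <= 1], the power of [relaxation K h] is at most the inverse of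
   [(1 + h / 2) ^+ n.+1], which Bernoulli bounds below by [1 + 1 / 2]. *)
have B : 3 / 2 <= (1 + h / 2) ^+ n.+1.
  have h20 : 0 <= h / 2 by lra.
  apply: le_trans (bernoulli_ineq n.+1 h20).
  by rewrite -mulrnAl h1; lra.
have : relaxation K h ^+ n.+1 * (1 + h / 2) ^+ n.+1 <= 1.
  rewrite -exprMn exprn_ile1//; first by rewrite mulr_ge0//; lra.
  have := ler_wpM2r (_ : 0 <= 1 + h / 2) lh; have := sqr_ge0 h.
  move=> hh /(_ _)/le_trans; apply; last by lra.
  by lra.
have := ler_wpM2l (exprn_ge0 n.+1 lh0) B.
move=> /le_trans/[apply]; move: (relaxation K h ^+ n.+1) => x; lra.
Qed.

(** * Paths without changes of state *)

(** Read as a real function with values 0 and 1, the path is continuous; if it took both values, it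
    would pass through [1 / 2] by the intermediate value theorem. *)
Lemma unchanged_cst (R : realType) (g : R -> bool) :
  (forall t, 0 <= t -> \forall s \near t^'+, g s = g t) ->
  (forall t, 0 < t <= 1 -> \forall s \near t^'-, g s = g t) ->
  forall t, 0 <= t <= 1 -> g t = g 0.
Proof.
move=> gr gl t /andP[t0 t1]; have [->//|tn0] := eqVneq t 0.
have t_gt0 : 0 < t by rewrite lt_neqAle eq_sym tn0.
apply/eqP; apply/negPn/negP => gt0.
pose h s : R := (g s)%:R.
have hr s : 0 <= s -> h x @[x --> s^'+] --> h s.
  move=> s0; apply: cvg_near_cst; have := gr s s0.
  by apply: filterS => x /= gx; rewrite /h gx.
have hl s : 0 < s <= 1 -> h x @[x --> s^'-] --> h s.
  move=> s0; apply: cvg_near_cst; have := gl s s0.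
  by apply: filterS => x /= gx; rewrite /h gx.
have hc : {within `[0, t], continuous h}.
  apply/continuous_within_itvP => //; split.
  - move=> s; rewrite in_itv /= => /andP[s0 st].
    apply/left_right_continuousP; split; last exact: hr (ltW s0).
    by apply: hl; rewrite s0 (le_trans (ltW st) t1).
  - exact: hr.
  - by apply: hl; rewrite t_gt0.
have [|c _] := @IVT _ h 0 t (1 / 2) t0 hc.
  move: gt0; rewrite /h; case: (g t); case: (g 0) => //= _.
    by rewrite min_l ?max_r//; lra.
  by rewrite min_r ?max_l//; lra.
by rewrite /h; case: (g c) => /= hc2; lra.
Qed.

Lemma number_of_changes_eq0 (R : realType) (g : R -> bool) :
  number_of_changes g = 0%E <->
  forall t, 0 < t <= 1 -> \forall s \near t^'-, g s = g t.
Proof.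
rewrite /number_of_changes /counting; split=> [|gl].
  case: asboolP => // fS /eqP.
  rewrite eqe pnatr_eq0 finmap.cardfs_eq0 => /eqP/(fset_set_set0 fS) S0.
  move=> t t01; apply: contrapT => ngl.
  by have : set0 t by rewrite -S0.
have -> : [set t : R | 0 < t <= 1 /\ ~ (\forall s \near t^'-, g s = g t)] =
    set0.
  by rewrite -subset0 => t /= [t01]; apply; apply: gl.
by rewrite fset_set0 /=; case: asboolP => // nf; case: nf.
Qed.

(* Countably many times suffice, whence the measurability of [C_n = 0]; [P] is
   not monotone on non-measurable sets. *)
Lemma number_of_changes_eq0_rat (R : realType) (g : R -> bool) :
  (forall t, 0 <= t -> \forall s \near t^'+, g s = g t) ->
  number_of_changes g = 0%E <->
  forall q : rat, 0 <= (ratr q : R) <= 1 -> g (ratr q) = g 0.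
Proof.
move=> gr; rewrite number_of_changes_eq0; split=> [gl q q01|gq].
  exact: unchanged_cst q01.
(* Right-continuity carries the value from rationals just above [t] to [t]. At [t = 1] these would
   leave the interval, but 1 is itself rational. *)
have g0 t : 0 <= t <= 1 -> g t = g 0.
  move=> /andP[t0]; rewrite le_eqVlt => /predU1P[->|t1].
    by have := gq 1; rewrite rmorph1 => ->//; rewrite ler01 lexx.
  have [e /= e0 He] := gr t t0.
  have [|q] := @rat_in_itvoo R t (Num.min 1 (t + e)).
    by rewrite lt_min t1 ltrDl.
  rewrite in_itv /= lt_min => /and3P[tq q1 qe].
  rewrite -(He (ratr q)) ?gq ?(le_trans t0 (ltW tq)) ?(ltW q1)//=.
  by rewrite ltr0_norm ?subr_lt0// opprB ltrBlDl.
move=> t /andP[t0 t1].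
near=> s; rewrite !g0 ?(ltW t0)//.
apply/andP; split; last first.
  by apply: le_trans t1; apply: ltW; near: s; exact: nbhs_left_lt.
by near: s; exact: nbhs_left_ge.
Unshelve. all: by end_near. Qed.

(** * Noise stability of a Boolean function *)

(** Agreement means both values true or both false, so the left side adds the forms of the indicator
    of [f] and of its complement. Their bounds sum to [rho + (1 - rho) * (u ^+ 2 + (1 - u) ^+
    2)]. *)
Lemma noise_stability_bound (R : realFieldType) (rho : R) (m : nat)
    (pi : 'I_m -> bool -> R) (l : 'I_m -> R) (f : {ffun 'I_m -> bool} -> bool)
    (u : R) :
  (forall i a, 0 <= pi i a) -> (forall i, pi i true + pi i false = 1) ->
  (forall i, 0 <= l i <= rho) -> rho <= 1 ->
  \sum_(x | f x) \prod_i pi i (x i) = u ->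
  \sum_(z : {ffun 'I_m -> bool} * {ffun 'I_m -> bool} | f z.1 == f z.2)
    \prod_i noisy_pair_weight (pi i) (l i) (z.1 i) (z.2 i) <=
  1 - 2 * (1 - rho) * (u * (1 - u)).
Proof.
move=> pi0 pi1 lrho rho1 uE0.
pose w (x : {ffun 'I_m -> bool}) := \prod_i pi i (x i).
pose N (x y : {ffun 'I_m -> bool}) :=
  \prod_i noisy_pair_weight (pi i) (l i) (x i) (y i).
pose F x : R := (f x)%:R.
have F2 x : F x ^+ 2 = F x by rewrite /F; case: (f x); rewrite ?expr1n ?expr0n.
have uE : \sum_x w x * F x = u.
  by rewrite -uE0 [RHS]big_mkcond; apply: eq_bigr => x _;
    rewrite -mulrb mulr_natr.
have w1 : \sum_x w x = 1 by exact: sum_product_weight.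
have uE2 : \sum_x w x * F x ^+ 2 = u.
  by rewrite -uE; apply: eq_bigr => x _; rewrite F2.
have uN : \sum_x w x * (1 - F x) = 1 - u.
  have -> : 1 - u = \sum_x w x - \sum_x w x * F x by rewrite w1 uE.
  by rewrite -sumrB; apply: eq_bigr => x _; ring.
have uN2 : \sum_x w x * (1 - F x) ^+ 2 = 1 - u.
  rewrite -uN; apply: eq_bigr => x _; congr (_ * _).
  by rewrite sqrrB F2; ring.
have H1 := noise_bound F pi0 pi1 lrho rho1.
have H0 := noise_bound (fun x => 1 - F x) pi0 pi1 lrho rho1.
rewrite -/w uE uE2 in H1; rewrite -/w uN uN2 in H0.
have -> : \sum_(z : {ffun 'I_m -> bool} * {ffun 'I_m -> bool} | f z.1 == f z.2)
      N z.1 z.2 =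
    \sum_x \sum_y N x y * (F x * F y) +
    \sum_x \sum_y N x y * ((1 - F x) * (1 - F y)).
  rewrite big_mkcond -(pair_big xpredT xpredT
    (fun x y => if f x == f y then N x y else 0)) /=.
  rewrite -big_split; apply: eq_bigr => x _.
  rewrite -big_split; apply: eq_bigr => y _ /=.
  by rewrite /F; case: (f x); case: (f y) => /=; ring.
apply: le_trans (lerD H1 H0) _; lra.
Qed.

Lemma sum_noisy_pair_weight (R : realFieldType) (m : nat)
    (pi : 'I_m -> bool -> R) (l : 'I_m -> R) (x : {ffun 'I_m -> bool}) :
  (forall i, pi i true + pi i false = 1) ->
  \sum_(y : {ffun 'I_m -> bool})
    \prod_i noisy_pair_weight (pi i) (l i) (x i) (y i) = \prod_i pi i (x i).
Proof.
move=> pi1; rewrite -(bigA_distr_bigA (fun i => noisy_pair_weight _ _ (x i))).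
apply: eq_bigr => i _; rewrite big_bool /noisy_pair_weight.
have -> : pi i false = 1 - pi i true by rewrite -(pi1 i); ring.
by case: (x i) => /=; ring.
Qed.

(** * Finite-valued random variables and events of a process *)

Lemma preimage_bigcup_fibers (T U : Type) (Z : T -> U) (Q : set U) :
  [set w | Q (Z w)] = \bigcup_(u in Q) [set w | Z w = u].
Proof. by apply/seteqP; split=> w /= => [Qw|[u /= Qu ->//]]; exists (Z w). Qed.

Lemma measurable_finite_valued (d : measure_display) (T : measurableType d)
    (U : finType) (Z : T -> U) (Q : pred U) :
  (forall u, measurable [set w | Z w = u]) -> measurable [set w | Q (Z w)].
Proof.
move=> mZ; rewrite (preimage_bigcup_fibers Z [set` Q]).
by apply: fin_bigcup_measurable => //; exact: finite_finset.
Qed.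

Lemma measure_finite_valued (R : realType) (d : measure_display)
    (T : measurableType d) (P : probability T R) (U : finType) (Z : T -> U)
    (Q : pred U) :
  (forall u, measurable [set w | Z w = u]) ->
  P [set w | Q (Z w)] = (\sum_(u | Q u) P [set w | Z w = u])%E.
Proof.
move=> mZ.
have trivZ : trivIset [set` Q] (fun u => [set w | Z w = u]).
  by move=> u v _ _ [w /= [<- <-]].
rewrite (preimage_bigcup_fibers Z [set` Q]) (measure_fin_bigcup _ _ trivZ)//.
rewrite (bigfs _ (r := index_enum U)) ?index_enum_uniq//.
by move=> u _; rewrite mem_index_enum.
Qed.

Lemma sum_law (R : realType) (d : measure_display) (T : measurableType d)
    (P : probability T R) (U : finType) (Z : T -> U) :
  (forall u, measurable [set w | Z w = u]) ->
  \sum_u fine (P [set w | Z w = u]) = 1.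
Proof.
move=> mZ; have := measure_finite_valued P xpredT mZ.
rewrite (_ : mkset _ = setT); last by apply/seteqP; split.
rewrite probability_setT => sum1; apply: EFin_inj; rewrite sum1 -sumEFin.
by apply: eq_bigr => u _; rewrite fineK// fin_num_measure.
Qed.

Lemma sigma_of_processT (R : realType) (T : pointedType) (S : Type) (D : set R)
    (X : R -> T -> S) : sigma_of_process D X setT.
Proof. exact: (@measurableT _ (g_sigma_algebraType _)). Qed.

(** Supplies the two-time events of a single bit to which independence is applied. *)
Lemma sigma_of_process_pair (R : realType) (T : pointedType) (S : Type)
    (D : set R) (X : R -> T -> S) (s t : R) (x y : S) :
  D s -> D t ->
  sigma_of_process D X ([set w | X s w = x] `&` [set w | X t w = y]).
Proof.
move=> Ds Dt.
apply: (@measurableI _ (g_sigma_algebraType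
  [set A | exists2 t, D t & exists x, A = [set w | X t w = x]])).
- by apply: sub_sigma_algebra; exists s => //; exists x.
- by apply: sub_sigma_algebra; exists t => //; exists y.
Qed.

Lemma observed_right_cst (R : realType) (T : Type) (m : nat)
    (f : {ffun 'I_m -> bool} -> bool) (X : 'I_m -> R -> T -> bool) (w : T) :
  (forall i, cadlag_path (fun t => X i t w)) ->
  forall t, 0 <= t ->
    \forall s \near t^'+, observed f X s w = observed f X t w.
Proof.
move=> cX t t0.
have : \forall s \near t^'+, forall i, X i s w = X i t w.
  by apply: filter_forall => i; exact: (cX i).1.
apply: filterS => s Xs; congr (f _); apply/ffunP => i.
by rewrite !ffunE.
Qed.

(** * Joint law of the bits at times 0 and 1 *)

(** A two-state stochastic matrix with invariant law [pi] is [l] times the identity plus [1 - l]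
    times resampling from [pi], where [l] is its second eigenvalue. Stationarity provides the
    invariance. *)
Lemma markov_bit_pair_law (R : realType) (d : measure_display)
    (T : measurableType d) (P : probability T R) (p : R) (X : R -> T -> bool) :
  continuous_time_markov_chain P (flip_rate p) X -> stationary_process P X ->
  exists l, 0 <= l <= 2 / 3 /\ forall a b,
    P ([set w | X 0 w = a] `&` [set w | X 1 w = b]) =
    (noisy_pair_weight (fun c => fine (P [set w | X 0 w = c])) l a b)%:E.
Proof.
move=> [mX _ [K [semiK rateK markX]]] statX.
exists (relaxation K 1); split.
  by rewrite relaxation_ge0//; exact: relaxation1_le rateK.
pose pi c := fine (P [set w | X 0 w = c]).
have piE c : P [set w | X 0 w = c] = (pi c)%:E.
  by rewrite fineK// fin_num_measure//; exact: mX.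
have joint a b : P ([set w | X 0 w = a] `&` [set w | X 1 w = b]) =
    (pi a * K 1 a b)%:E.
  (* The Markov property at time 0 with a trivial past. *)
  have := markX 0 1 a b setT (lexx _) ler01 (@sigma_of_processT _ _ _ _ _).
  by rewrite setTI subr0 piE EFinM.
have pi1 : P [set w | X 1 w = true] = (pi true)%:E.
  rewrite -piE.
  have := statX 1 (fun=> 0) (fun=> true) 1 ler01 (fun=> lexx _).
  rewrite add0r.
  have E t : [set w | forall j : 'I_1, X t w = true] = [set w | X t w = true].
    by apply/seteqP; split=> w /= => [/(_ ord0)|].
  by rewrite !E.
have balance : pi true * K 1 true true + pi false * K 1 false true = pi true.
  have mXX a b : measurable ([set w | X 0 w = a] `&` [set w | X 1 w = b]).
    by apply: measurableI; exact: mX.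
  have disj : [set w | X 0 w = true] `&` [set w | X 1 w = true] `&`
      ([set w | X 0 w = false] `&` [set w | X 1 w = true]) = set0.
    by rewrite -subset0 => w /= [[-> _] []].
  apply: EFin_inj; rewrite -pi1 EFinD -!joint -measureU//.
  congr (P _); rewrite -setIUl; apply/seteqP; split=> w /=; first by case.
  by case: (X 0 w) => ->; split=> //; [left|right].
have total : pi true + pi false = 1.
  by rewrite -(sum_law P (Z := X 0)) ?big_bool// => c; exact: mX.
case: semiK => _ K1 _ _.
have Kt : K 1 true true = 1 - K 1 true false.
  by have := K1 1 true ler01; rewrite big_bool /=; lra.
have Kf : K 1 false false = 1 - K 1 false true.
  by have := K1 1 false ler01; rewrite big_bool /=; lra.
have q : pi false = 1 - pi true by lra.
move=> a b; rewrite joint -/pi /noisy_pair_weight /relaxation; congr EFin.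
move: balance; rewrite q Kt => balance.
(* Detailed balance, which for two states follows from invariance; its multiple by [pi true]
   supplies the products of degree three in the identity to be checked. *)
have bal : pi true * K 1 true false = (1 - pi true) * K 1 false true by lra.
have bal2 : pi true * K 1 true false * pi true =
  (1 - pi true) * K 1 false true * pi true by rewrite bal.
by case: a; case: b => /=; rewrite ?q ?Kt ?Kf; lra.
Qed.

Definition two_times (R : realType) (T : Type) (m : nat)
    (X : 'I_m -> R -> T -> bool) (s t : R) (w : T) :
    {ffun 'I_m -> bool} * {ffun 'I_m -> bool} :=
  ([ffun i => X i s w], [ffun i => X i t w]).

Lemma two_times_fiber (R : realType) (T : Type) (m : nat)
    (X : 'I_m -> R -> T -> bool) (s t : R) z :
  [set w | two_times X s t w = z] =
  \bigcap_i ([set w | X i s w = z.1 i] `&` [set w | X i t w = z.2 i]).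
Proof.
apply/seteqP; split=> w /= => [<- i _|Xz]; first by rewrite /= !ffunE.
case: z Xz => x y Xz.
by congr pair; apply/ffunP => i; have [/= Xx Xy] := Xz i I; rewrite ffunE.
Qed.

Lemma measurable_two_times (R : realType) (d : measure_display)
    (T : measurableType d) (m : nat) (X : 'I_m -> R -> T -> bool) (s t : R) z :
  (forall i r x, 0 <= r -> measurable [set w | X i r w = x]) ->
  0 <= s -> 0 <= t -> measurable [set w | two_times X s t w = z].
Proof.
move=> mX s0 t0; rewrite two_times_fiber.
apply: fin_bigcap_measurable; first exact: finite_finset.
by move=> i _; apply: measurableI; exact: mX.
Qed.

Lemma measurable_no_change (R : realType) (d : measure_display)
    (T : measurableType d) (m : nat) (f : {ffun 'I_m -> bool} -> bool)
    (X : 'I_m -> R -> T -> bool) :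
  (forall i t x, 0 <= t -> measurable [set w | X i t w = x]) ->
  (forall i w, cadlag_path (fun t => X i t w)) ->
  measurable
    [set w | number_of_changes (fun t => observed f X t w) = 0%E].
Proof.
move=> mX cX.
pose Q (q : rat) (z : {ffun 'I_m -> bool} * {ffun 'I_m -> bool}) :=
  (0 <= (ratr q : R) <= 1) ==> (f z.1 == f z.2).
have -> : [set w | number_of_changes (fun t => observed f X t w) = 0%E] =
    ~` \bigcup_q ~` [set w | Q q (two_times X (ratr q) 0 w)].
  have C0P w := number_of_changes_eq0_rat (observed_right_cst f (cX^~ w)).
  apply/seteqP; split=> w /=.
    move=> /C0P gq [q _]; apply; apply/implyP => q01.
    by rewrite /= -/(observed f X _ w); apply/eqP; exact: gq.
  move=> C0; apply/C0P => q q01; apply: contrapT => neq.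
  apply: C0; exists q => //= /implyP/(_ q01)/eqP; exact: neq.
apply: measurableC; apply: countable_bigcupT_measurable => // q.
(* Fibers are known to be measurable only at nonnegative times; at negative [ratr q] the condition
   [Q q] is vacuous. *)
apply: measurableC; have [q0|q0] := boolP (0 <= (ratr q : R)).
  by apply: measurable_finite_valued => z; exact: measurable_two_times.
suff -> : [set w | Q q (two_times X (ratr q) 0 w)] = setT by [].
by apply/seteqP; split=> w //= _; rewrite /Q (negbTE q0).
Qed.

Lemma two_times_law (R : realType) (d : measure_display)
    (T : measurableType d) (P : probability T R) (m : nat) (p : R)
    (X : 'I_m -> R -> T -> bool) :
  dynamical_bits P p X ->
  let pi i c := fine (P [set w | X i 0 w = c]) in
  exists l : 'I_m -> R, (forall i, 0 <= l i <= 2 / 3) /\ forall z,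
    P [set w | two_times X 0 1 w = z] =
    (\prod_i noisy_pair_weight (pi i) (l i) (z.1 i) (z.2 i))%:E.
Proof.
move=> [bits indep] pi.
(* Each chain has its own kernel, so the parameter is chosen bit by bit. *)
have /choice[l Hl] i := markov_bit_pair_law (bits i).1 (bits i).2.
exists l; split=> [i|z]; first exact: (Hl i).1.
rewrite two_times_fiber indep; last first.
  by move=> i; apply: sigma_of_process_pair; rewrite /= in_itv /= ?ler01 ?lexx.
by congr EFin; apply: eq_bigr => i _; rewrite (Hl i).2.
Qed.

(** * Variance against the probability of a change, and the limit *)

(** The constant is [1 / (2 * (1 - rho))] at [rho = 2 / 3]; it depends on neither [p] nor [m], as
    the passage to the limit requires. *)
Lemma variance_le_change (R : realType) (d : measure_display)
    (T : measurableType d) (P : probability T R) (m : nat) (p : R)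
    (f : {ffun 'I_m -> bool} -> bool) (X : 'I_m -> R -> T -> bool) :
  dynamical_bits P p X ->
  (P [set w | observed f X 0 w = true] * P [set w | observed f X 0 w = false] <=
   (3 / 2)%:E *
   (1 - P [set w | number_of_changes (fun t => observed f X t w) = 0]))%E.
Proof.
move=> dynX; have [bits _] := dynX.
have mX i t x : 0 <= t -> measurable [set w | X i t w = x].
  by have [[mXi _ _] _] := bits i; exact: mXi.
have cX i w : cadlag_path (fun t => X i t w).
  by have [[_ cXi _] _] := bits i; exact: cXi.
have [l [lbnd law]] := two_times_law dynX.
pose pi i c := fine (P [set w | X i 0 w = c]).
have pi0 i c : 0 <= pi i c by exact: fine_ge0.
have pi1 i : pi i true + pi i false = 1.
  by rewrite -(sum_law P (Z := X i 0)) ?big_bool// => c; exact: mX.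
pose N (x y : {ffun 'I_m -> bool}) :=
  \prod_i noisy_pair_weight (pi i) (l i) (x i) (y i).
have mZ z : measurable [set w | two_times X 0 1 w = z].
  by apply: measurable_two_times.
have lawQ (Q : pred _) : P [set w | Q (two_times X 0 1 w)] =
    (\sum_(z | Q z) N z.1 z.2)%:E.
  by rewrite measure_finite_valued// -sumEFin; apply: eq_bigr => z _.
pose u := \sum_(x | f x) \prod_i pi i (x i).
have f0 : P [set w | observed f X 0 w = true] = u%:E.
  rewrite (lawQ (fun z => f z.1)); congr EFin; rewrite /u.
  (* The condition is put in product form so that the configuration at time 1 can be summed out. *)
  rewrite (eq_bigl (fun z => f z.1 && true)) => [|z]; last by rewrite andbT.
  rewrite -(pair_big f xpredT (fun x y => N x y)) /=.
  by apply: eq_bigr => x _; exact: sum_noisy_pair_weight.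
have f1 : P [set w | observed f X 0 w = false] = (1 - u)%:E.
  rewrite EFinB -f0 -probability_setC; last first.
    by apply: (measurable_finite_valued (fun z => f z.1) mZ).
  congr (P _); apply/seteqP; split=> w /=; first by move=> ->.
  by move=> /negP/negbTE.
have mC := measurable_no_change f mX cX.
set C := [set w | _] in mC *.
(* Without a change the values at times 0 and 1 agree, so [C] lies in the agreement event. *)
have leC : (P C <= (\sum_(z | f z.1 == f z.2) N z.1 z.2)%:E)%E.
  rewrite -lawQ; apply: le_measure; rewrite ?inE//.
    exact: (measurable_finite_valued (fun z => f z.1 == f z.2) mZ).
  move=> w /= /number_of_changes_eq0 gl; rewrite eq_sym.
  apply/eqP; apply: (unchanged_cst _ gl); last by rewrite ler01 lexx.
  exact: observed_right_cst.
have PC : P C = (fine (P C))%:E by rewrite fineK// fin_num_measure.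
have rho1 : (2 / 3 : R) <= 1 by lra.
have stab := noise_stability_bound pi0 pi1 lbnd rho1 (erefl u).
rewrite PC lee_fin in leC; have := le_trans leC stab.
rewrite PC f0 f1 -EFinB -!EFinM lee_fin; lra.
Qed.

Theorem proposition1p2 (R : realType) (d : nat -> measure_display)
    (T : forall n : nat, measurableType (d n))
    (P : forall n : nat, probability (T n) R)
    (m : nat -> nat)
    (f : forall n : nat, {ffun 'I_(m n) -> bool} -> bool)
    (p : nat -> R)
    (X : forall n : nat, 'I_(m n) -> R -> T n -> bool)
    (hp : forall n : nat, 0 <= p n <= 1)
    (hX : forall n : nat, dynamical_bits (P n) (p n) (X n))
    (hlame : lame P f X) :
  degenerate P f X.
Proof.
rewrite /degenerate.
pose c n := P n [set w | number_of_changes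
  (fun t => observed (f n) (X n) t w) = 0%E].
apply: (@squeeze_cvge _ _ _ R (cst 0%E) _ (fun n => (3 / 2)%:E * (1 - c n))%E).
- apply: nearW => n; rewrite mule_ge0//=.
  exact: variance_le_change.
- exact: cvg_cst.
(* The limit 0 is written as [3 / 2] times [1 - 1], where the second 1 is the limit of [c] given by
   lameness. *)
- rewrite -(mule0 (3 / 2)%:E); apply: cvgeZl => //.
  rewrite -(@subee _ 1%E)//; apply: cvgeB => //.
  exact: cvg_cst.
Qed.
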